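(* Let $(A,\sigma)$ be a semisimple Hermitian involutive algebra. Let $\mathrm{O}(A_{\mathbb{C}},\sigma_{\mathbb{C}})\times\mathrm{O}(A_{\mathbb{C}},\sigma_{\mathbb{C}})$ act on $A_{\mathbb{C}}$ by $(k_1,k_2).q=k_1qk_2^{-1}$, and let $\mathrm{O}(A_{\mathbb{C}},\sigma_{\mathbb{C}})$ act on $A_{\mathbb{C}}^{\sigma_{\mathbb{C}}}$ by conjugation. Then the morphism of affine GIT quotients $$\hat{\mathcal N}_{\mathbb{C}}\colon A_{\mathbb{C}}/\!\!/\bigl(\mathrm{O}(A_{\mathbb{C}},\sigma_{\mathbb{C}})\times\mathrm{O}(A_{\mathbb{C}},\sigma_{\mathbb{C}})\bigr)\longrightarrow A_{\mathbb{C}}^{\sigma_{\mathbb{C}}}/\!\!/\mathrm{O}(A_{\mathbb{C}},\sigma_{\mathbb{C}})$$ induced by $q\mapsto \sigma_{\mathbb{C}}(q)q$ is an isomorphism.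
   Context: $A$ is a unital associative, possibly noncommutative, finite-dimensional semisimple $\mathbb{R}$-algebra and $\sigma\colon A\to A$ is an anti-involution: $\mathbb{R}$-linear, $\sigma(ab)=\sigma(b)\sigma(a)$, $\sigma^2=\mathrm{Id}$. Put $A^\sigma=\{a\in A\mid\sigma(a)=a\}$, $A^\times$ the group of invertible elements, $\mathrm{O}(A,\sigma)=\{a\in A^\times\mid \sigma(a)=a^{-1}\}$, $A^\sigma_+=\{a^2\mid a\in A^\sigma\cap A^\times\}$, $A^\sigma_{\ge 0}=\{a^2\mid a\in A^\sigma\}$. The pair $(A,\sigma)$ is Hermitian if for $x,y\in A^\sigma$, $x^2+y^2=0$ implies $x=y=0$; as standing properties of Hermitian algebras, $A^\sigma_+$ and $A^\sigma_{\ge0}$ are proper convex cones in $A^\sigma$, $\mathrm{O}(A,\sigma)$ is compact, and $x\mapsto ax\sigma(a)$ preserves $A^\sigma_+$ and $A^\sigma_{\geq 0}$ for every $a\in A^\times$. $A_\mathbb{C}=A\otimes_\mathbb{R}\mathbb{C}$, $\sigma_\mathbb{C}$ is the $\mathbb{C}$-linear extension of $\sigma$, $A_\mathbb{C}^{\sigma_\mathbb{C}}=\{a\in A_\mathbb{C}\mid\sigma_\mathbb{C}(a)=a\}$, $\mathrm{O}(A_\mathbb{C},\sigma_\mathbb{C})=\{a\in A_\mathbb{C}^\times\mid\sigma_\mathbb{C}(a)=a^{-1}\}$. For a complex reductive group $H$ acting linearly on a finite-dimensional complex vector space $W$, $W/\!\!/H=\mathrm{Spec}\,\mathbb{C}[W]^H$.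 The map $q\mapsto\sigma_\mathbb{C}(q)q$ sends $(k_1,k_2).q$ to $k_2\,\sigma_\mathbb{C}(q)q\,k_2^{-1}$. *)

(* Defs.v *)
From HB Require Import structures.
From mathcomp Require Import all_boot all_order all_algebra all_field.
From mathcomp Require Import ring_quotient complex mpoly.
From mathcomp Require Import boolp classical_sets functions reals.
From mathcomp Require Import topology_structure.

Set Implicit Arguments.
Unset Strict Implicit.
Unset Printing Implicit Defensive.

Import GRing.Theory VectorInternalTheory.
Local Open Scope ring_scope.
Local Open Scope classical_set_scope.

Definition left_ideal (K : fieldType) (A : falgType K) (I : {vspace A}) : Prop :=
  ({:A} * I <= I)%VS.

Definition simple_left_ideal (K : fieldType) (A : falgType K)
    (I : {vspace A}) : Prop :=
  [/\ left_ideal I, I <> 0%VS &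
      forall J : {vspace A}, left_ideal J -> (J <= I)%VS -> J = 0%VS \/ J = I].

(* The regular left module is a finite direct sum of simple submodules. *)
Definition semisimple_algebra (K : fieldType) (A : falgType K) : Prop :=
  exists (n : nat) (I : 'I_n -> {vspace A}),
    [/\ forall i, simple_left_ideal (I i),
        directv (\sum_i I i) & (\sum_i I i)%VS = {:A}%VS].

Record anti_involution (R : realType) (A : falgType R) := AntiInvolution {
  anti_inv_fun :> {linear A -> A};
  anti_invM : forall a b : A,
    anti_inv_fun (a * b) = anti_inv_fun b * anti_inv_fun a;
  anti_invK : involutive anti_inv_fun }.

Definition hermitian_algebra (R : realType) (A : falgType R)
    (sigma : anti_involution A) : Prop :=
  forall x y : A, sigma x = x -> sigma y = y ->
    x ^+ 2 + y ^+ 2 = 0 -> x = 0 /\ y = 0.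

(* [Cplx a b] stands for a (x) 1 + b (x) i in A (x)_R R[i]. *)
Record complexification (A : Type) := Cplx { cre : A; cim : A }.

Definition complexification_pair (A : Type) (x : complexification A) :=
  (cre x, cim x).
Definition complexification_of_pair (A : Type) (x : A * A) := Cplx x.1 x.2.

Lemma complexification_pairK (A : Type) :
  cancel (@complexification_pair A) (@complexification_of_pair A).
Proof. by case. Qed.

HB.instance Definition _ (A : choiceType) :=
  Choice.copy (complexification A) (can_type (@complexification_pairK A)).

Section Complexification.
Variables (R : rcfType) (A : falgType R).
Local Notation AC := (complexification A).
Implicit Types x y z : AC.

Lemma eq_cplx x y : cre x = cre y -> cim x = cim y -> x = y.
Proof. by case: x y => [a b] [c d] /= -> ->. Qed.

Definition cplx_add x y := Cplx (cre x + cre y) (cim x + cim y).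
Definition cplx_opp x := Cplx (- cre x) (- cim x).
Definition cplx_mul x y :=
  Cplx (cre x * cre y - cim x * cim y) (cre x * cim y + cim x * cre y).
Definition cplx_scale (c : R[i]) x :=
  Cplx (complex.Re c *: cre x - complex.Im c *: cim x)
       (complex.Re c *: cim x + complex.Im c *: cre x).

Fact cplx_addA : associative cplx_add.
Proof. by move=> x y z; apply: eq_cplx; rewrite /= addrA. Qed.
Fact cplx_addC : commutative cplx_add.
Proof. by move=> x y; apply: eq_cplx; rewrite /= addrC. Qed.
Fact cplx_add0 : left_id (Cplx 0 0) cplx_add.
Proof. by move=> x; apply: eq_cplx; rewrite /= add0r. Qed.
Fact cplx_addN : left_inverse (Cplx 0 0) cplx_opp cplx_add.
Proof. by move=> x; apply: eq_cplx; rewrite /= addNr. Qed.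
HB.instance Definition _ := GRing.isZmodule.Build AC cplx_addA cplx_addC cplx_add0 cplx_addN.

Fact cplx_mulA : associative cplx_mul.
Proof.
by move=> x y z; apply: eq_cplx;
  rewrite /= !(mulrDl, mulrDr, mulrN, mulNr, mulrA) ?opprD -!addrA;
  congr (_ + _); rewrite addrA addrC.
Qed.
Fact cplx_mul1l : left_id (Cplx 1 0) cplx_mul.
Proof. by move=> x; apply: eq_cplx; rewrite /= !mul1r !mul0r ?subr0 ?addr0. Qed.
Fact cplx_mul1r : right_id (Cplx 1 0) cplx_mul.
Proof. by move=> x; apply: eq_cplx; rewrite /= !mulr1 !mulr0 ?subr0 ?add0r. Qed.
Fact cplx_mulDl : left_distributive cplx_mul +%R.
Proof.
by move=> x y z; apply: eq_cplx; rewrite /= !mulrDl ?opprD addrACA.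
Qed.
Fact cplx_mulDr : right_distributive cplx_mul +%R.
Proof.
by move=> x y z; apply: eq_cplx; rewrite /= !mulrDr ?opprD addrACA.
Qed.
Fact cplx_one_neq0 : Cplx 1 0 != 0 :> AC.
Proof. by apply/eqP => -[/eqP]; rewrite oner_eq0. Qed.
HB.instance Definition _ := GRing.Zmodule_isNzRing.Build AC
  cplx_mulA cplx_mul1l cplx_mul1r cplx_mulDl cplx_mulDr cplx_one_neq0.

Fact cplx_scaleA c d x : cplx_scale c (cplx_scale d x) = cplx_scale (c * d) x.
Proof.
by case: c d => [a b] [a' b']; apply: eq_cplx;
  rewrite /= !(scalerDl, scalerDr, scalerN, scaleNr, scalerA) ?opprD -!addrA;
  congr (_ + _); rewrite addrA addrC.
Qed.
Fact cplx_scale1 : left_id 1 cplx_scale.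
Proof.
by move=> x; apply: eq_cplx; rewrite /= scale1r scale0r ?subr0 ?addr0.
Qed.
Fact cplx_scaleDr : right_distributive cplx_scale +%R.
Proof.
by move=> c x y; apply: eq_cplx; rewrite /= !scalerDr ?opprD addrACA.
Qed.
Fact cplx_scaleDl x : {morph cplx_scale^~ x : c d / c + d}.
Proof.
by move=> [a b] [c d]; apply: eq_cplx; rewrite /= !scalerDl ?opprD addrACA.
Qed.
HB.instance Definition _ := GRing.Zmodule_isLmodule.Build R[i] AC
  cplx_scaleA cplx_scale1 cplx_scaleDr cplx_scaleDl.

Fact cplx_scaleAl (c : R[i]) x y : c *: (x * y) = (c *: x) * y.
Proof.
by apply: eq_cplx;
  rewrite /= !(mulrDl, scalerDr, scalerN, mulNr, scalerAl) ?opprD -!addrA;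
  congr (_ + _); rewrite addrA addrC.
Qed.
HB.instance Definition _ := GRing.Lmodule_isLalgebra.Build R[i] AC cplx_scaleAl.

Fact cplx_scaleAr (c : R[i]) x y : c *: (x * y) = x * (c *: y).
Proof.
by apply: eq_cplx;
  rewrite /= !(mulrDr, scalerDr, scalerN, mulrN, scalerAr) ?opprD -!addrA;
  congr (_ + _); rewrite addrCA.
Qed.
HB.instance Definition _ := GRing.Lalgebra_isAlgebra.Build R[i] AC cplx_scaleAr.

Fact complexification_vector : Vector.axiom (dim A) AC.
Proof.
pose f x : 'rV[R[i]]_(dim A) := \row_j Complex (v2r (cre x) 0 j) (v2r (cim x) 0 j).
exists f.
  move=> [a b] x y; apply/rowP => j.
  by rewrite !mxE /= !linearD /= linearN !linearZ /= !mxE mulrN.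
exists (fun v : 'rV[R[i]]_(dim A) =>
  Cplx (r2v (map_mx (@complex.Re R) v)) (r2v (map_mx (@complex.Im R) v))).
  by move=> x; apply: eq_cplx; apply: (canLR v2rK); apply/rowP => j; rewrite !mxE.
by move=> v; apply/rowP => j; rewrite !mxE /= !r2vK !mxE; case: (v 0 j).
Qed.
HB.instance Definition _ :=
  Lmodule_hasFinDim.Build R[i] AC complexification_vector.
HB.instance Definition _ := Algebra_isFalgebra.Build R[i] AC.

End Complexification.

Section ComplexifiedInvolution.
Variables (R : realType) (A : falgType R) (sigma : anti_involution A).
Local Notation AC := (complexification A).

Definition sigmaC (x : AC) : AC := Cplx (sigma (cre x)) (sigma (cim x)).

Fact sigmaC_linear : linear sigmaC.
Proof.
by move=> c x y; apply: eq_cplx; rewrite /= !linearD /= ?linearN !linearZ.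
Qed.
HB.instance Definition _ :=
  GRing.isLinear.Build R[i] AC AC *:%R sigmaC sigmaC_linear.

Lemma sigmaCM x y : sigmaC (x * y) = sigmaC y * sigmaC x.
Proof.
apply: eq_cplx; rewrite /= !linearD ?linearN /= !anti_invM //.
by rewrite addrC.
Qed.

Lemma sigmaCK : involutive sigmaC.
Proof. by move=> x; apply: eq_cplx; rewrite /= anti_invK. Qed.

Definition symC : {vspace AC} := fixedSpace (linfun sigmaC).

Lemma mem_symC x : (x \in symC) = (sigmaC x == x).
Proof. by apply/fixedSpaceP/eqP; rewrite lfunE. Qed.

Record orthC := OrthC {
  orthC_val :> AC;
  orthC_unit : orthC_val \is a GRing.unit;
  orthCE : sigmaC orthC_val = orthC_val^-1 }.

Definition twosided_act (k : orthC * orthC) (q : AC) : AC :=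
  (k.1 : AC) * q * (k.2 : AC)^-1.

Fact conj_symC (k : orthC) (s : subvs_of symC) :
  (k : AC) * vsval s * (k : AC)^-1 \in symC.
Proof.
rewrite mem_symC !sigmaCM -orthCE sigmaCK orthCE mulrA.
by have:= subvsP s; rewrite mem_symC => /eqP ->.
Qed.
Definition conj_act (k : orthC) (s : subvs_of symC) : subvs_of symC :=
  Subvs (conj_symC k s).

Fact cplx_norm_sym (q : AC) : sigmaC q * q \in symC.
Proof. by rewrite mem_symC sigmaCM sigmaCK. Qed.
Definition cplx_norm (q : AC) : subvs_of symC := Subvs (cplx_norm_sym q).

Lemma cplx_norm_equivariant (k : orthC * orthC) (q : AC) :
  cplx_norm (twosided_act k q) = conj_act k.2 (cplx_norm q).
Proof.
apply: val_inj; rewrite /= /twosided_act !sigmaCM.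
rewrite -(orthCE k.2) sigmaCK (orthCE k.1) orthCE !mulrA; congr (_ * _ * _).
by rewrite divrK // orthC_unit.
Qed.

End ComplexifiedInvolution.

Section Invariants.
Variables (K : fieldType) (W : vectType K).

Definition polyfun (p : {mpoly K[\dim {:W}]}) : W -> K :=
  fun w => p.@[fun i => coord (vbasis {:W}) i w].

Definition polynomial_function (f : W -> K) : Prop := exists p, f = polyfun p.

Lemma polynomial_functionC c : polynomial_function (fun=> c).
Proof. by exists c%:MP; apply/funext => w; rewrite /polyfun mevalC. Qed.

Lemma polynomial_function_coord i :
  polynomial_function (coord (vbasis {:W}) i).
Proof. by exists 'X_i; apply/funext => w; rewrite /polyfun mevalXU. Qed.

Lemma polynomial_functionD f g : polynomial_function f ->
  polynomial_function g -> polynomial_function (fun w => f w + g w).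
Proof.
move=> [p ->] [q ->]; exists (p + q); apply/funext => w.
by rewrite /polyfun mevalD.
Qed.

Lemma polynomial_functionN f :
  polynomial_function f -> polynomial_function (fun w => - f w).
Proof.
by move=> [p ->]; exists (- p); apply/funext => w; rewrite /polyfun mevalN.
Qed.

Lemma polynomial_functionM f g : polynomial_function f ->
  polynomial_function g -> polynomial_function (fun w => f w * g w).
Proof.
move=> [p ->] [q ->]; exists (p * q); apply/funext => w.
by rewrite /polyfun mevalM.
Qed.

Lemma polynomial_function_sum I (r : seq I) (F : I -> W -> K) :
  (forall i, polynomial_function (F i)) ->
  polynomial_function (fun w => \sum_(i <- r) F i w).
Proof.
move=> pF; elim: r => [|i r IHr].
  by under eq_fun do rewrite big_nil; apply: polynomial_functionC.
by under eq_fun do rewrite big_cons; apply: polynomial_functionD.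
Qed.

Lemma polynomial_function_prod I (r : seq I) (F : I -> W -> K) :
  (forall i, polynomial_function (F i)) ->
  polynomial_function (fun w => \prod_(i <- r) F i w).
Proof.
move=> pF; elim: r => [|i r IHr].
  by under eq_fun do rewrite big_nil; apply: polynomial_functionC.
by under eq_fun do rewrite big_cons; apply: polynomial_functionM.
Qed.

Lemma polynomial_functionX f n : polynomial_function f ->
  polynomial_function (fun w => f w ^+ n).
Proof.
move=> pf; elim: n => [|n IHn].
  by under eq_fun do rewrite expr0; apply: polynomial_functionC.
by under eq_fun do rewrite exprS; apply: polynomial_functionM.
Qed.

Variables (H : Type) (act : H -> W -> W).

(* K[W]^H, realized inside the ring of all functions W -> K: over an infinite
   field a polynomial is determined by the function it defines. *)
Definition invariant : {pred W -> K} :=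
  fun f => `[< polynomial_function f /\ forall h w, f (act h w) = f w >].

Record invariants := Invariants {
  invariant_fun :> W -> K;
  invariant_funP : invariant_fun \in invariant }.

HB.instance Definition _ := [isSub for invariant_fun].
HB.instance Definition _ := [Choice of invariants by <:].

Lemma invariantsP (f : invariants) :
  polynomial_function f /\ forall h w, f (act h w) = f w.
Proof. exact/asboolP/(invariant_funP f). Qed.

Fact invariant_subring : subring_closed invariant.
Proof.
split.
- by apply/asboolP; split=> //; apply: polynomial_functionC.
- move=> f g /asboolP[pf hf] /asboolP[pg hg]; apply/asboolP; split.
    exact/polynomial_functionD/polynomial_functionN.
  by move=> h w; rewrite /GRing.add /GRing.opp /= hf hg.
- move=> f g /asboolP[pf hf] /asboolP[pg hg]; apply/asboolP; split.
    exact: polynomial_functionM.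
  by move=> h w; rewrite /GRing.mul /= hf hg.
Qed.
HB.instance Definition _ :=
  GRing.isSubringClosed.Build (W -> K) invariant invariant_subring.
HB.instance Definition _ := GRing.SubChoice_isSubComPzRing.Build
  (W -> K) invariant invariants invariant_subring.

Fact invariants_oner_neq0 : 1 != 0 :> invariants.
Proof.
apply/eqP => /(congr1 val)/(congr1 (fun f : W -> K => f 0))/eqP.
exact/negP/oner_neq0.
Qed.
HB.instance Definition _ :=
  GRing.PzSemiRing_isNonZero.Build invariants invariants_oner_neq0.

End Invariants.

Lemma polynomial_function_comp (K : fieldType) (V W : vectType K)
    (phi : V -> W) (f : W -> K) :
  (forall i, polynomial_function (fun v => coord (vbasis {:W}) i (phi v))) ->
  polynomial_function f -> polynomial_function (f \o phi).
Proof.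
move=> pphi [p ->]; rewrite /polyfun /comp /=.
under eq_fun do rewrite mevalE.
apply: polynomial_function_sum => m.
apply: polynomial_functionM; first exact: polynomial_functionC.
by apply: polynomial_function_prod => i; apply: polynomial_functionX.
Qed.

Section Spec.
Variable B : comNzRingType.

Definition prime_ideal (I : B -> bool) : bool :=
  `[< idealr_closed I /\ prime_idealr_closed I >].

Definition spec := {I : B -> bool | prime_ideal I}.

HB.instance Definition _ := Choice.on spec.

Definition spec_ideal (p : spec) : {pred B} := sval p.

Implicit Types (p : spec) (U V : set spec) (s : spec -> set (B * B)).

Lemma specP p : idealr_closed (spec_ideal p) /\ prime_idealr_closed (spec_ideal p).
Proof. exact/asboolP/(svalP p). Qed.

Lemma spec0 p : 0 \in spec_ideal p. Proof. by have [[]] := specP p. Qed.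

Lemma spec1 p : 1 \notin spec_ideal p. Proof. by have [[]] := specP p. Qed.

Lemma specM p a b : (a * b \in spec_ideal p) = (a \in spec_ideal p) || (b \in spec_ideal p).
Proof.
have [[p0 _ pD] pM] := specP p; apply/idP/idP; first exact: pM.
by case/orP => ?; [rewrite mulrC|]; rewrite -[_ * _]addr0 pD.
Qed.

Definition zariski_open U : Prop :=
  exists E : set B, U = [set p | exists2 a, E a & a \notin spec_ideal p].

Fact zariski_openT : zariski_open setT.
Proof.
exists setT; apply/seteqP; split=> // p _; exists 1 => //; exact: spec1.
Qed.

Fact zariski_openI : setI_closed zariski_open.
Proof.
move=> _ _ [E ->] [F ->].
exists [set x | exists a b, [/\ E a, F b & x = a * b]].
apply/seteqP; split=> p /=.
  move=> [[a Ea pa] [b Fb pb]]; exists (a * b); first by exists a, b.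
  by rewrite specM negb_or pa.
move=> [_ [a [b [Ea Fb ->]]]]; rewrite specM negb_or => /andP[pa pb].
by split; [exists a|exists b].
Qed.

Fact zariski_open_bigU (I : Type) (f : I -> set spec) :
  (forall i, zariski_open (f i)) -> zariski_open (\bigcup_i f i).
Proof.
move=> fo; exists [set a | exists i, [set p | a \notin spec_ideal p] `<=` f i].
apply/seteqP; split=> p /=.
  move=> [i _ fip]; have [E fE] := fo i; move: (fip); rewrite fE => -[a Ea pa].
  by exists a => //; exists i => q /= qa; rewrite fE; exists a.
by move=> [a [i sai] pa]; exists i => //; apply: sai.
Qed.

HB.instance Definition _ := isOpenTopological.Build spec
  zariski_openT zariski_openI zariski_open_bigU.

Lemma spec_openE U : open U = zariski_open U.
Proof. by []. Qed.

(* The element a/b of the local ring B_p (with b \notin p), encoded as its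
   equivalence class of pairs (numerator, denominator). *)
Definition local_frac p (a b : B) : set (B * B) :=
  [set x | x.2 \notin spec_ideal p /\
     exists2 t, t \notin spec_ideal p & t * (a * x.2 - x.1 * b) = 0].

(* Sections of the structure sheaf over U: families of elements of the local
   rings B_p, p in U, which are locally fractions.  As families are indexed by
   all of Spec B, they are given the junk value set0 outside U. *)
Definition sections U : set (spec -> set (B * B)) :=
  [set s | (forall p, ~ U p -> s p = set0) /\
     forall p, U p -> exists V a b, [/\ open V, V p, V `<=` U &
       forall q, V q -> b \notin spec_ideal q /\ s q = local_frac q a b]].

End Spec.

Section SpecMap.
Variables (B C : comNzRingType) (phi : {rmorphism B -> C}).

Fact spec_map_subproof (q : spec C) :
  prime_ideal (fun a => phi a \in spec_ideal q).
Proof.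
have [[q0 q1 qD] qM] := specP q; apply/asboolP; split; [split|].
- by rewrite unfold_in rmorph0.
- by rewrite unfold_in rmorph1.
- by move=> a x y; rewrite !unfold_in rmorphD rmorphM => qx qy; apply: qD.
- by move=> a b; rewrite !unfold_in rmorphM; apply: qM.
Qed.

Definition spec_map (q : spec C) : spec B :=
  exist (@prime_ideal B) _ (spec_map_subproof q).

(* The action of spec_map on sections: at q, the fraction a/b in the local ring
   at spec_map q is sent to phi a / phi b in the local ring at q. *)
Definition section_map (s : spec B -> set (B * B)) : spec C -> set (C * C) :=
  fun q => [set y | exists2 x, s (spec_map q) x &
                      local_frac q (phi x.1) (phi x.2) y].

(* The morphism Spec C -> Spec B is an isomorphism of (locally) ringed spaces:
   a homeomorphism, together with bijections O(U) -> O(spec_map^-1 U); these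
   are ring morphisms, the operations on sections being computed in the local
   rings. *)
Definition spec_isomorphism : Prop :=
  (exists g : spec B -> spec C,
     [/\ cancel spec_map g, cancel g spec_map,
         continuous spec_map & continuous g]) /\
  forall U : set (spec B), open U ->
    set_bij (sections U) (sections (spec_map @^-1` U)) section_map.

End SpecMap.

Section GITNorm.
Variables (R : realType) (A : falgType R) (sigma : anti_involution A).

Definition twosided_invariants := invariants (@twosided_act R A sigma).
Definition conj_invariants := invariants (@conj_act R A sigma).

Fact cplx_norm_polynomial i :
  polynomial_function (fun q : complexification A =>
    coord (vbasis {:subvs_of (symC sigma)}) i (cplx_norm sigma q)).
Proof.
pose e := vbasis {:complexification A}.
rewrite (_ : (fun q => _) = fun q =>
  \sum_k \sum_l coord e k q * (coord e l q *
    coord (vbasis {:subvs_of (symC sigma)}) i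
      (vsproj (symC sigma) (sigmaC sigma e`_k * e`_l)))).
  apply: polynomial_function_sum => k; apply: polynomial_function_sum => l.
  apply: polynomial_functionM; first exact: polynomial_function_coord.
  apply: polynomial_functionM; first exact: polynomial_function_coord.
  exact: polynomial_functionC.
apply/funext => q; rewrite /cplx_norm SubvsE.
rewrite {1 2}(coord_vbasis (memvf q)) linear_sum mulr_suml !linear_sum.
apply: eq_bigr => k _; rewrite mulr_sumr !linear_sum.
by apply: eq_bigr => l _; rewrite linearZ /= -scalerAl -scalerAr !linearZ.
Qed.

Fact norm_pullback_subproof (f : conj_invariants) :
  (f : _ -> _) \o @cplx_norm R A sigma \in invariant (@twosided_act R A sigma).
Proof.
have [pf fP] := invariantsP f; apply/asboolP; split.
  by apply: polynomial_function_comp => // i; apply: cplx_norm_polynomial.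
by move=> k q /=; rewrite cplx_norm_equivariant fP.
Qed.

(* The comorphism f |-> f \o N of q |-> sigmaC q * q; the induced morphism of GIT
   quotients goes from Spec of its target to Spec of its source. *)
Definition norm_pullback (f : conj_invariants) : twosided_invariants :=
  Invariants (norm_pullback_subproof f).

Fact norm_pullback_additive : zmod_morphism norm_pullback.
Proof. by move=> f g; apply: val_inj. Qed.
Fact norm_pullback_multiplicative : monoid_morphism norm_pullback.
Proof. by split=> [|f g]; apply: val_inj. Qed.
HB.instance Definition _ :=
  GRing.isZmodMorphism.Build conj_invariants twosided_invariants norm_pullback norm_pullback_additive.
HB.instance Definition _ := GRing.isMonoidMorphism.Build
  conj_invariants twosided_invariants norm_pullback norm_pullback_multiplicative.

End GITNorm.

(* Main.v *)
Require Import Defs.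
From HB Require Import structures.
From mathcomp Require Import all_boot all_algebra all_field reals.
From mathcomp Require Import ring complex mpoly.
From mathcomp Require Import boolp classical_sets functions topology_structure.

(* The comorphism f |-> f o N, N(q) = sigma(q) q, is bijective, hence induces an
   isomorphism of spectra.  Every invertible s in A_C has a square root in C[s],
   so an invertible symmetric s is N(r) with r symmetric, N is dominant and the
   comorphism is injective.  Conversely, let F be an invariant polynomial on A_C.
   An invertible q is k r with r = sqrt(N(q)) and k in O(A_C), so only an f
   with f(r^2) = F(r) for symmetric r is needed, and as A^sigma is Zariski dense
   in its complexification, r may be taken in A^sigma.  As (A, sigma) is
   Hermitian, C[r] is then reduced, so r = sum a_i e_i with symmetric orthogonal
   idempotents e_i.  Invariance under sum (+-e_i) makes P(x) = F(sum x_i e_i)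
   even in each x_i, so with y = r^2 the function
   t |-> F(sqrt(1 + t (y - 1))) is a polynomial of degree at most deg F, whose
   value F(r) at t = 1 is a linear function of its jet at t = 0.  Replacing sqrt
   by a polynomial g with g^2 = X modulo a high power of X - 1 does not change
   this jet, and gives the polynomial formula
   f(y) = sum_l w_l F(g(1 + l (y - 1))) with universal weights w_l. *)

Set Implicit Arguments.
Unset Strict Implicit.
Unset Printing Implicit Defensive.

Import GRing.Theory Num.Theory.
Local Open Scope ring_scope.

(** * Polynomials in an element of a finite-dimensional algebra *)

Section ClosedFieldPoly.
Variable K : numClosedFieldType.
Implicit Types p q g : {poly K}.

(* Given g^2 = X + h p, replace g by g + c p: c has to solve the equation
   p(a) c^2 + 2 g(a) c + h(a) = 0, which is not constant in c, since p(a) = 0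
   forces g(a)^2 = a <> 0. *)
Lemma sqrtX_mod (s : seq K) : 0 \notin s ->
  exists g, \prod_(a <- s) ('X - a%:P) %| g ^+ 2 - 'X.
Proof.
elim: s => [|a s IHs]; first by exists 0; rewrite big_nil dvd1p.
rewrite inE negb_or eq_sym => /andP[a_neq0 /IHs[g /dvdpP[h Dh]]].
set p := \prod_(b <- s) _ in Dh.
pose q := p.[a] *: 'X^2 + (g.[a] *+ 2) *: 'X + h.[a]%:P.
have [c /rootP qc0] : exists c, root q c.
  apply/closed_rootP/eqP => /eq_leq q_le1.
  have := nth_default 0 q_le1; have := nth_default 0 (leqW q_le1).
  rewrite !coefE /= !(mulr0, mulr1, addr0, add0r) => pa0 /eqP.
  rewrite mulrn_eq0 /= => /eqP ga0.
  have := congr1 (horner^~ a) Dh; rewrite !hornerE pa0 ga0 mulr0 expr0n sub0r.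
  by move=> /eqP; rewrite oppr_eq0 (negPf a_neq0).
exists (g + c *: p); rewrite big_cons -/p.
have -> : (g + c *: p) ^+ 2 - 'X = (h + (c *+ 2) *: g + c ^+ 2 *: p) * p.
  rewrite -!mul_polyC polyCMn rmorphXn /= 2!mulrDl -Dh; ring.
apply: dvdp_mul => //; rewrite dvdp_XsubCl; apply/rootP.
by rewrite -[RHS]qc0 !(hornerD, hornerZ, hornerXn, hornerX, hornerC); ring.
Qed.

Lemma eq_poly_nat p q : (forall n : nat, p.[n%:R] = q.[n%:R]) -> p = q.
Proof.
move=> pq; apply/eqP; rewrite -subr_eq0; apply/eqP.
apply: (@roots_geq_poly_eq0 _ _ [seq i%:R | i <- iota 0 (size (p - q))]).
- by apply/allP => _ /mapP[i _ ->]; rewrite rootE !hornerE pq subrr.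
- by rewrite map_inj_uniq ?iota_uniq //; apply: (@mulrIn K 1); rewrite oner_eq0.
- by rewrite size_map size_iota.
Qed.

(** Lagrange interpolation at the nodes 0, ..., n writes any linear functional on polynomials of
    degree at most n as a weighted sum of values. The functional used is the value at 1 of the
    truncation below X^m. *)
Lemma interpolation_weights m n : exists w : 'I_n.+1 -> K, forall p,
  (size p <= n.+1)%N -> \sum_l w l * p.[l%:R] = (take_poly m p).[1].
Proof.
have injx : injective (fun i : nat => i%:R : K).
  by apply: (@mulrIn K 1); rewrite oner_eq0.
exists (fun l => (take_poly m (tnth (lagrange n.+1 (fun i : nat => i%:R)) l)).[1]).
move=> p sp; rewrite [p in RHS](lagrange_gen (ltn0Sn n) injx sp) take_poly_sum horner_sum.
by apply: eq_bigr => l _; rewrite mul_polyC take_polyZ hornerZ mulrC.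
Qed.

End ClosedFieldPoly.

Section FalgebraPoly.
Variables (K : fieldType) (B : falgType K).
Implicit Types (x y : B) (p q : {poly K}).

Lemma annihilating_poly x : exists2 p, p != 0 & horner_alg x p = 0.
Proof.
apply: contrapT => nop.
pose X := [tuple x ^+ i | i < (\dim {:B}).+1].
suff: free X.
  rewrite /free size_tuple => /eqP dX.
  by have := dimvS (subvf <<X>>); rewrite dX ltnn.
apply/freeP => k kX0; pose p := \poly_(i < (\dim {:B}).+1) k (inord i).
suff p0 : p = 0.
  by move=> i; have := congr1 (coefp i) p0; rewrite /= coef_poly coef0 ltn_ord inord_val.
apply: contrapT => p_neq0; apply: nop; exists p; first by apply/eqP.
rewrite /p poly_def linear_sum -[RHS]kX0; apply: eq_bigr => i _.
by rewrite linearZ /= rmorphXn /= horner_algX inord_val nth_mktuple mulr_algl.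
Qed.

Lemma comm_horner_alg x p q : GRing.comm (horner_alg x p) (horner_alg x q).
Proof. by rewrite /GRing.comm -!rmorphM mulrC. Qed.

Lemma horner_alg_dvd x p q : p %| q -> horner_alg x p = 0 -> horner_alg x q = 0.
Proof. by move=> /dvdpP[r ->] xp0; rewrite rmorphM /= xp0 mulr0. Qed.

(** Evaluating p - p(a) = q (X - a) at x gives -p(a) = q(x) (x - a), which inverts x - a up to a
    nonzero scalar. *)
Lemma unit_sub_scalar x p a : horner_alg x p = 0 -> p.[a] != 0 ->
  x - a%:A \is a GRing.unit.
Proof.
move=> xp0 pa; have : root (p - p.[a]%:P) a by rewrite rootE !hornerE subrr.
move=> /factor_theorem[q Dq].
have xE : horner_alg x ('X - a%:P) = x - a%:A.
  by rewrite rmorphB /= horner_algX horner_algC.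
have : horner_alg x (q * ('X - a%:P)) = (- p.[a])%:A.
  by rewrite -Dq rmorphB /= xp0 horner_algC sub0r scaleNr.
rewrite rmorphM /= xE => qx; apply/unitrP.
have nz : - p.[a] != 0 by rewrite oppr_eq0.
exists ((- p.[a])^-1 *: horner_alg x q); rewrite -scalerAl -scalerAr -{2}xE.
by rewrite comm_horner_alg xE qx scalerA mulVf ?scale1r.
Qed.

Lemma horner_alg_comp x p q :
  horner_alg x (p \Po q) = horner_alg (horner_alg x q) p.
Proof.
elim/poly_ind: p => [|p c IHp]; first by rewrite comp_poly0 !rmorph0.
rewrite comp_polyD comp_polyM comp_polyX comp_polyC !rmorphD !rmorphM /=.
by rewrite IHp !horner_algX !horner_algC.
Qed.

(** [s] reverses products, but all factors are polynomials in x and commute. *)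
Lemma horner_alg_fixed (s : {linear B -> B}) x p :
  (forall y z, s (y * z) = s z * s y) -> s 1 = 1 -> s x = x ->
  s (horner_alg x p) = horner_alg x p.
Proof.
move=> sM s1 sx; elim/poly_ind: p => [|p c IHp]; first by rewrite rmorph0 linear0.
rewrite rmorphD rmorphM /= horner_algX horner_algC linearD linearZ /= sM.
rewrite sx IHp s1; congr (_ + _).
by have := comm_horner_alg x 'X p; rewrite /GRing.comm horner_algX.
Qed.

End FalgebraPoly.

Section ClosedFalgebra.
Variables (K : numClosedFieldType) (B : falgType K).
Implicit Types (x : B) (p q : {poly K}).

(** The root 0 is removed by dividing an annihilating polynomial by its full power of X, which is
    invertible at x. *)
Lemma unit_annihilating_poly x : x \is a GRing.unit ->
  exists2 s, 0 \notin s & horner_alg x (\prod_(a <- s) ('X - a%:P)) = 0.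
Proof.
move=> ux; have [p p_neq0 xp0] := annihilating_poly x.
have [k [q]] := multiplicity_XsubC p 0; rewrite p_neq0 /= => q0 Dp.
have xq0 : horner_alg x q = 0.
  move: xp0; rewrite Dp rmorphM rmorphXn /= subr0 horner_algX => /eqP.
  by rewrite mulIr_eq0 ?(can_inj (mulrK _)) ?unitrX //; [move/eqP|apply/mulIr/unitrX].
have [s Dq] := closed_field_poly_normal q.
have q_neq0 : q != 0 by apply: contraNneq p_neq0 => q_eq0; rewrite Dp q_eq0 mul0r.
exists s; first by move: q0; rewrite Dq rootZ ?root_prod_XsubC ?lead_coef_eq0.
move: xq0; rewrite Dq linearZ /= => /eqP; rewrite mulr_algl scaler_eq0 lead_coef_eq0.
by rewrite (negPf q_neq0) => /eqP.
Qed.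

Lemma unit_sqrt x : x \is a GRing.unit -> exists g, horner_alg x g ^+ 2 = x.
Proof.
move=> /unit_annihilating_poly[s s0 xs0]; have [g gs] := sqrtX_mod s0.
exists g; apply/eqP; rewrite -rmorphXn -subr_eq0 -{2}[x]horner_algX -rmorphB.
exact/eqP/(horner_alg_dvd gs).
Qed.

(** A nonzero p has finitely many roots, so x + n is invertible for almost all natural n; the
    density arguments rest on this. *)
Lemma unit_add_nat x : exists2 p : {poly K}, p != 0 &
  forall n : nat, p.[n%:R] != 0 -> x + n%:R%:A \is a GRing.unit.
Proof.
have [p p_neq0 xp0] := annihilating_poly x; exists (p \Po (- 'X)).
  by rewrite comp_poly_eq0 ?size_polyN ?size_polyX.
move=> n; rewrite horner_comp !hornerE => pn.
by rewrite -[n%:R]opprK scaleNr; apply: unit_sub_scalar pn.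
Qed.

End ClosedFalgebra.

(** * Polynomial maps *)

Section PolynomialMaps.
Variable K : fieldType.

Definition polynomial_map (V W : vectType K) (phi : V -> W) : Prop :=
  forall i, polynomial_function (fun v => coord (vbasis {:W}) i (phi v)).

Lemma polynomial_map_linear (V W : vectType K) (phi : {linear V -> W}) :
  polynomial_map phi.
Proof.
move=> i; rewrite (_ : (fun v => _) = fun v => \sum_j coord (vbasis {:V}) j v *
    coord (vbasis {:W}) i (phi (vbasis {:V})`_j)).
  apply: polynomial_function_sum => j; apply: polynomial_functionM.
    exact: polynomial_function_coord.
  exact: polynomial_functionC.
apply/funext => v; rewrite {1}(coord_vbasis (memvf v)) !linear_sum.
by apply: eq_bigr => j _; rewrite !linearZ.
Qed.

Lemma polynomial_map_cst (V W : vectType K) (w : W) :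
  polynomial_map (fun _ : V => w).
Proof. by move=> i; apply: polynomial_functionC. Qed.

Lemma polynomial_mapD (V W : vectType K) (phi psi : V -> W) :
  polynomial_map phi -> polynomial_map psi ->
  polynomial_map (fun v => phi v + psi v).
Proof.
move=> pphi ppsi i; under eq_fun do rewrite linearD.
apply: polynomial_functionD; [exact: pphi|exact: ppsi].
Qed.

Lemma polynomial_mapM (V : vectType K) (B : falgType K) (phi psi : V -> B) :
  polynomial_map phi -> polynomial_map psi ->
  polynomial_map (fun v => phi v * psi v).
Proof.
move=> pphi ppsi i; pose e := vbasis {:B}.
rewrite (_ : (fun v => _) = fun v => \sum_k \sum_l
    coord e k (phi v) * (coord e l (psi v) * coord e i (e`_k * e`_l))).
  apply: polynomial_function_sum => k; apply: polynomial_function_sum => l.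
  apply: polynomial_functionM => //; apply: polynomial_functionM => //.
  exact: polynomial_functionC.
apply/funext => v; rewrite {1}(coord_vbasis (memvf (phi v))).
rewrite {1}(coord_vbasis (memvf (psi v))) mulr_suml !linear_sum.
apply: eq_bigr => k _; rewrite mulr_sumr !linear_sum.
by apply: eq_bigr => l _; rewrite -scalerAl -scalerAr !linearZ.
Qed.

Lemma polynomial_map_horner_alg (V : vectType K) (B : falgType K)
    (phi : V -> B) (g : {poly K}) :
  polynomial_map phi -> polynomial_map (fun v => horner_alg (phi v) g).
Proof.
move=> pphi; elim/poly_ind: g => [|g c IHg].
  under eq_fun do rewrite rmorph0; exact: polynomial_map_cst.
under eq_fun do rewrite rmorphD rmorphM /= horner_algX horner_algC.
apply: polynomial_mapD; last exact: polynomial_map_cst.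
exact: polynomial_mapM.
Qed.

Lemma polynomial_function_line (W : vectType K) (f : W -> K) (u v : W) :
  polynomial_function f -> exists p : {poly K}, forall t, f (u + t *: v) = p.[t].
Proof.
move=> [P ->]; pose e := vbasis {:W}.
exists (\sum_(m <- msupp P) P@_m *:
          \prod_i ((coord e i u)%:P + coord e i v *: 'X) ^+ m i).
move=> t; rewrite /polyfun mevalE horner_sum; apply: eq_bigr => m _.
rewrite hornerZ horner_prod; congr (_ * _); apply: eq_bigr => i _.
by rewrite horner_exp !hornerE linearD linearZ /= mulrC.
Qed.

End PolynomialMaps.

(** On the line both sides are polynomials in t. Multiplied by p they agree at every natural number,
    hence identically, and p cancels. *)
Lemma polynomial_function_line_eq (K : numClosedFieldType) (W : vectType K)
    (f g : W -> K) (u v : W) (p : {poly K}) :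
  polynomial_function f -> polynomial_function g -> p != 0 ->
  (forall n : nat, p.[n%:R] != 0 -> f (u + n%:R *: v) = g (u + n%:R *: v)) ->
  forall t, f (u + t *: v) = g (u + t *: v).
Proof.
move=> pf pg p_neq0 fg t.
have [a fE] := polynomial_function_line u v pf.
have [b gE] := polynomial_function_line u v pg.
rewrite fE gE; congr (_.[_]); apply: (mulIf p_neq0); apply: eq_poly_nat => n.
rewrite !hornerM -fE -gE; have [->|/fg->//] := eqVneq p.[n%:R] 0.
by rewrite !mulr0.
Qed.

(** * Even polynomials and interpolation *)

Section EvenPolynomials.
Variable K : numClosedFieldType.

(** Averaging over the 2^n sign changes kills each monomial with an odd exponent and keeps the
    others. *)
Lemma meval_even n (P : {mpoly K[n]}) :
  (forall (eps : {ffun 'I_n -> bool}) x,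
    P.@[fun i => (-1) ^+ eps i * x i] = P.@[x]) ->
  forall x, P.@[x] =
    \sum_(m <- msupp P | [forall i, ~~ odd (m i)]) P@_m * \prod_i x i ^+ m i.
Proof.
move=> evP x; apply: (@mulfI _ (2 ^+ n)); first by rewrite expf_neq0 ?pnatr_eq0.
have -> : 2 ^+ n * P.@[x] =
    \sum_(eps : {ffun 'I_n -> bool}) P.@[fun i => (-1) ^+ eps i * x i].
  under eq_bigr do rewrite evP.
  by rewrite sumr_const card_ffun card_bool card_ord -[RHS]mulr_natl natrX.
under eq_bigr do rewrite mevalE.
rewrite exchange_big /= mulr_sumr [RHS]big_mkcond /=; apply: eq_bigr => m _.
transitivity (P@_m * \prod_i x i ^+ m i *
    \sum_(eps : {ffun 'I_n -> bool}) \prod_i (-1 : K) ^+ (eps i * m i)).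
  rewrite mulr_sumr; apply: eq_bigr => eps _; rewrite -mulrA; congr (_ * _).
  by rewrite -big_split; apply: eq_bigr => i _; rewrite exprMn -exprM mulrC.
(* The sum over sign vectors factors over the coordinates, with factors 1 + (-1)^(m i). *)
rewrite -(bigA_distr_bigA (fun i (b : bool) => (-1 : K) ^+ (b * m i))) mulrC.
have sumE i : \sum_(b : bool) (-1 : K) ^+ (b * m i) = if odd (m i) then 0 else 2.
  rewrite big_bool /= mul1n mul0n expr0 -signr_odd.
  by case: (odd _); rewrite ?expr1 ?addNr ?expr0.
case: ifPn => [/forallP evm|/forallPn[j]].
  under eq_bigr => i do rewrite sumE (negPf (evm i)).
  by rewrite prodr_const card_ord.
by rewrite negbK => oddj; rewrite (bigD1 j) //= sumE oddj !mul0r.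
Qed.

Lemma size_prod_exp n (p : 'I_n -> {poly K}) (m : 'I_n -> nat) (c : nat) :
  (forall i, (size (p i) <= c.+1)%N) ->
  (size (\prod_i p i ^+ m i)%R <= (c * \sum_i m i).+1)%N.
Proof.
move=> sp; rewrite big_distrr /=.
apply: (big_rec2 (fun (p : {poly K}) d => (size p <= d.+1)%N)).
  by rewrite size_poly1.
move=> i d q _ sq; apply: (leq_trans (size_polyMleq _ _)).
have := leq_trans (size_poly_exp_leq (p i) (m i)) (_ : _ <= (c * m i).+1)%N.
rewrite ltnS leq_mul2r -ltnS.
have -> : ((size (p i)).-1 < c.+1)%N = true.
  by rewrite ltnS; case: (size _) (sp i).
rewrite orbT => /(_ isT) spm.
by rewrite -subn1 leq_subLR add1n -addSn -addnS leq_add.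
Qed.

Lemma dvdp_sub_prod_exp n (D : {poly K}) (p q : 'I_n -> {poly K}) (m : 'I_n -> nat) :
  (forall i, D %| p i - q i) ->
  D %| \prod_i p i ^+ m i - \prod_i q i ^+ m i.
Proof.
move=> Dpq; have mulD a b a' b' : D %| a - a' -> D %| b - b' -> D %| a * b - a' * b'.
  move=> Da Db; rewrite (_ : _ - _ = (a - a') * b + a' * (b - b')).
    by apply: dvdp_add; [apply: dvdp_mulr|apply: dvdp_mull].
  by rewrite mulrBl mulrBr addrA subrK.
apply: (big_ind2 (fun p q => D %| p - q)) => [||i _].
- by rewrite subrr dvdp0.
- by move=> ? ? ? ?; apply: mulD.
elim: (m i) => [|k IHk]; first by rewrite !expr0 subrr dvdp0.
by rewrite !exprS mulD.
Qed.

(* For even P, t |-> P(sqrt(1 + t (a_i^2 - 1))) is a polynomial of degree at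
   most d; it is determined by its jet at t = 0, where the polynomial g is an
   approximate square root, and takes the value P(a) at t = 1. *)
Lemma even_interpolation (d : nat) :
  exists (g : {poly K}) (N : nat) (w : 'I_N -> K),
  forall n (P : {mpoly K[n]}) (a : 'I_n -> K), (msize P <= d.+1)%N ->
    (forall (eps : {ffun 'I_n -> bool}) x,
      P.@[fun i => (-1) ^+ eps i * x i] = P.@[x]) ->
    \sum_l w l * P.@[fun i => g.[1 + l%:R * (a i ^+ 2 - 1)]] = P.@[a].
Proof.
(* Repeating the root 1 makes g^2 agree with X modulo (X - 1)^(d + 1). *)
have [] := @sqrtX_mod K (nseq d.+1 1); first by rewrite mem_nseq eq_sym oner_eq0.
move=> g; rewrite big_nseq iter_mulr_1 => /dvdpP[h gh].
have [w wP] := interpolation_weights K d.+1 (size g * d).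
exists g, (size g * d).+1, w => n P a sP evP.
under eq_bigr do rewrite (meval_even evP) mulr_sumr.
rewrite exchange_big /= (meval_even evP) big_seq_cond [RHS]big_seq_cond.
apply: eq_bigr => m /andP[mP /forallP evm].
have sm : (\sum_i m i <= d)%N.
  by rewrite -mdegE -ltnS (leq_trans (msize_mdeg_lt mP)).
pose L i : {poly K} := 1 + (a i ^+ 2 - 1) *: 'X.
have sL i : (size (L i) <= 2)%N.
  rewrite (leq_trans (size_polyD _ _)) // geq_max size_poly1 /=.
  by rewrite (leq_trans (size_scale_leq _ _)) // size_polyX.
(* [phi] uses the approximate roots of the L_i, [psi] the exact ones. They agree modulo X^(d + 1)
   because X divides L_i - 1, and deg psi <= d, so truncating [phi] gives exactly [psi], whose value
   at 1 is the monomial at a. *)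
pose phi := \prod_i (g \Po L i) ^+ m i.
pose psi := \prod_i L i ^+ (m i)./2.
have phiE : phi = \prod_i ((g \Po L i) ^+ 2) ^+ (m i)./2.
  by apply: eq_bigr => i _; rewrite -exprM mul2n even_halfK.
have sphi : (size phi <= (size g * d).+1)%N.
  apply: leq_trans (@size_prod_exp _ (fun i => g \Po L i) m (size g) _) _ => [i|].
    apply: leq_trans (size_comp_poly_leq _ _) _; rewrite ltnS.
    rewrite -[leqRHS]muln1 leq_mul ?leq_pred //.
    by move: (sL i); case: (size _).
  by rewrite ltnS leq_mul2l sm orbT.
have spsi : (size psi <= d.+1)%N.
  apply: leq_trans (@size_prod_exp _ L (fun i => (m i)./2) 1%N sL) _.
  rewrite mul1n ltnS; apply: leq_trans sm; apply: leq_sum => i _.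
  by rewrite -{2}[m i]even_halfK // -addnn leq_addr.
have : 'X^(d.+1) %| phi - psi.
  rewrite phiE; apply: dvdp_sub_prod_exp => i.
  have -> : (g \Po L i) ^+ 2 - L i = (g ^+ 2 - 'X) \Po L i.
    by rewrite comp_polyB comp_polyX rmorphXn.
  rewrite gh comp_polyM rmorphXn /= comp_polyB comp_polyX comp_polyC.
  by rewrite {2}/L addrAC subrr add0r exprZn dvdp_mull // -mul_polyC dvdp_mull.
move=> /dvdpP[r] /(canRL (subrK _)) phi_psi.
transitivity (P@_m * \sum_l w l * phi.[l%:R]).
  rewrite mulr_sumr; apply: eq_bigr => l _; rewrite mulrCA; congr (_ * (_ * _)).
  rewrite horner_prod; apply: eq_bigr => i _.
  by rewrite horner_exp horner_comp /L !hornerE mulrC.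
rewrite wP // phi_psi addrC take_polyDMXn // horner_prod; congr (_ * _).
apply: eq_bigr => i _; rewrite horner_exp /L hornerD hornerZ hornerX -[1]/1%:P.
rewrite hornerC mulr1 addrC subrK.
by rewrite -exprM mul2n even_halfK.
Qed.

End EvenPolynomials.

(** [msize] is 2 in degree one. This bounds the degree of F in linear coordinates on a subspace,
    uniformly in the subspace. *)
Lemma msize_comp_mpoly_le (K : idomainType) n k (P : {mpoly K[n]})
    (lq : n.-tuple {mpoly K[k]}) :
  (forall i, msize (tnth lq i) <= 2)%N -> (msize (P \mPo lq) <= msize P)%N.
Proof.
move=> lq2; have leM (p q : {mpoly K[k]}) a b : (msize p <= a.+1)%N ->
    (msize q <= b.+1)%N -> (msize (p * q)%R <= (a + b).+1)%N.
  have [->|p0] := eqVneq p 0; first by rewrite mul0r msize0.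
  have [->|q0] := eqVneq q 0; first by rewrite mulr0 msize0.
  move=> pa qb; rewrite msizeM // -subn1 leq_subLR add1n -addSn -addnS.
  exact: leq_add.
rewrite comp_mpolyEX big_seq.
apply: (big_ind (fun p : {mpoly K[k]} => msize p <= msize P)%N).
- by rewrite msize0.
- by move=> p q sp sq; rewrite (leq_trans (msizeD_le _ _)) // geq_max sp.
move=> m /msize_mdeg_lt mP; apply: leq_trans (msizeZ_le _ _) (leq_trans _ mP).
rewrite comp_mpolyX mdegE.
apply: (big_rec2 (fun (p : {mpoly K[k]}) d => msize p <= d.+1)%N).
  by rewrite msize1.
move=> i d q _ sq; apply: (leM) => //.
elim: (m i) => [|c IHc]; first by rewrite expr0 msize1.
by rewrite exprS (leM _ _ 1%N).
Qed.

(** At an element annihilated by the product of the X - a_i, these polynomials become orthogonal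
    idempotents e_i. *)
Lemma lagrange_basis (K : fieldType) n (a : 'I_n -> K) : injective a ->
  exists L : 'I_n -> {poly K}, forall i j, (L i).[a j] = (i == j)%:R.
Proof.
move=> inja; pose M i := \prod_(j | j != i) ('X - (a j)%:P).
exists (fun i => (M i).[a i]^-1 *: M i) => i j; rewrite hornerZ.
have [<-|ij] := eqVneq i j.
  rewrite mulVf // horner_prod; apply/prodf_neq0 => k ki.
  by rewrite hornerXsubC subr_eq0 eq_sym (inj_eq inja).
by rewrite [X in _ * X]horner_prod (bigD1 j) 1?eq_sym //= hornerXsubC subrr mul0r mulr0.
Qed.

(** * Diagonalization of elements generating a reduced subalgebra *)

Section Reduced.
Variables (K : numClosedFieldType) (B : falgType K) (x : B).
Hypothesis redx : forall p, horner_alg x p ^+ 2 = 0 -> horner_alg x p = 0.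

(** The exponent is raised to a power of two and then halved repeatedly by [redx]. *)
Lemma horner_alg_reduced p N : horner_alg x p ^+ N = 0 -> horner_alg x p = 0.
Proof.
move=> pN0; have : horner_alg x p ^+ (2 ^ N) = 0.
  by rewrite -(subnK (ltnW (ltn_expl N (ltnSn 1)))) exprD pN0 mulr0.
elim: N {pN0} => [|N IHN]; first by rewrite expr1.
by rewrite expnSr exprM -rmorphXn => /redx; rewrite rmorphXn => /IHN.
Qed.

(** The a_i are the distinct roots of an annihilating polynomial. It divides a power of the product
    of the X - a_i, so this product is nilpotent at x, hence zero there, and it divides every q
    vanishing at the a_i. *)
Lemma diagonalizable_of_reduced : exists n (a : 'I_n -> K), injective a /\
  forall q, (forall i, q.[a i] = 0) -> horner_alg x q = 0.
Proof.
have [p p_neq0 xp0] := annihilating_poly x.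
have [s Dp] := closed_field_poly_normal p.
pose t := undup s; exists (size t), (fun i => t`_i); split.
  by move=> i j /eqP; rewrite nth_uniq ?undup_uniq // => /eqP/val_inj.
have xt0 : horner_alg x (\prod_(a <- t) ('X - a%:P)) = 0.
  apply: (@horner_alg_reduced _ (size s)); rewrite -rmorphXn.
  apply: horner_alg_dvd xp0; rewrite Dp.
  rewrite dvdpZl ?lead_coef_eq0 //.
  have : {subset s <= t} by move=> a; rewrite mem_undup.
  elim: {1 2 3}s => [|a r IHr] st; first by rewrite big_nil dvd1p.
  rewrite big_cons exprS dvdp_mul //.
    by rewrite dvdp_XsubCl root_prod_XsubC st ?mem_head.
  by apply: IHr => b rb; rewrite st // inE rb orbT.
move=> q q0; apply: horner_alg_dvd xt0; apply: uniq_roots_dvdp.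
  apply/allP => a /(nthP 0) [k kt <-]; rewrite rootE.
  by apply/eqP; have := q0 (Ordinal kt).
by rewrite uniq_rootsE undup_uniq.
Qed.

End Reduced.

(** * Spectra of isomorphic rings *)

Section SpecIsomorphism.
Local Open Scope classical_set_scope.

Section LocalFrac.
Variables (B : comNzRingType) (p : spec B).
Implicit Types a b : B.

Lemma local_frac_refl a b : b \notin spec_ideal p -> local_frac p a b (a, b).
Proof.
by move=> pb; split=> //; exists 1; [exact: spec1|rewrite subrr mulr0].
Qed.

Lemma local_frac_sym a b c d : b \notin spec_ideal p ->
  local_frac p a b (c, d) -> local_frac p c d (a, b).
Proof.
move=> pb [/= pd [t pt Dt]]; split=> //=; exists t => //.
by rewrite -opprB mulrN Dt oppr0.
Qed.

Lemma local_frac_trans a b c d x :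
  local_frac p a b (c, d) -> local_frac p c d x -> local_frac p a b x.
Proof.
move=> [/= pd [t pt Dt]] [/= px [s ps Ds]]; split=> //.
(* Both multipliers and the middle denominator enter the witness, since d must be cancelled. *)
exists (d * t * s); first by rewrite !specM !negb_or pd pt ps.
transitivity (s * x.2 * (t * (a * d - c * b)) + t * b * (s * (c * x.2 - x.1 * d))).
  by ring.
by rewrite Dt Ds !mulr0 addr0.
Qed.

Lemma local_frac_eq a b c d : b \notin spec_ideal p ->
  local_frac p a b (c, d) -> local_frac p a b = local_frac p c d.
Proof.
move=> pb abcd; apply/seteqP; split=> x; last exact: local_frac_trans.
by apply: local_frac_trans; apply: local_frac_sym.
Qed.

End LocalFrac.

Lemma continuous_spec_map (B C : comNzRingType) (f : {rmorphism B -> C}) :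
  continuous (spec_map f).
Proof.
apply/continuousP => _ [E ->]; exists (f @` E).
apply/seteqP; split=> q /=; first by move=> [a Ea qa]; exists (f a) => //; exists a.
by move=> [_ [a Ea <-] qa]; exists a.
Qed.

Lemma spec_mapK (B C : comNzRingType) (f : {rmorphism B -> C})
    (g : {rmorphism C -> B}) : cancel g f -> cancel (spec_map f) (spec_map g).
Proof.
by move=> gK q; apply/val_inj/funext => a /=; rewrite /spec_ideal /= unfold_in gK.
Qed.

Section SpecIso.
Variables (B C : comNzRingType).
Variables (phi : {rmorphism B -> C}) (psi : {rmorphism C -> B}).
Hypotheses (phiK : cancel phi psi) (psiK : cancel psi phi).

Lemma local_frac_map (q : spec C) a b x :
  local_frac q (phi a) (phi b) (phi x.1, phi x.2) <->
  local_frac (spec_map phi q) a b x.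
Proof.
split=> -[/= qx [t qt Dt]]; split=> //.
  exists (psi t); first by rewrite /spec_ideal /= unfold_in psiK.
  by apply: (can_inj phiK); rewrite rmorph0 -Dt !(rmorphM, rmorphB) /= psiK.
exists (phi t) => //=.
by rewrite -!rmorphM -rmorphB -rmorphM Dt rmorph0.
Qed.

(** [section_map] collects the images of all representatives; as [phi] respects equivalence of
    pairs, they form a single class. *)
Lemma section_map_frac (s : spec B -> set (B * B)) q a b :
  b \notin spec_ideal (spec_map phi q) ->
  s (spec_map phi q) = local_frac (spec_map phi q) a b ->
  section_map phi s q = local_frac q (phi a) (phi b).
Proof.
move=> qb sE; apply/seteqP; split=> y.
  rewrite /section_map /= sE => -[x /local_frac_map ax]; exact: local_frac_trans.
by move=> ay; exists (a, b) => //=; rewrite sE; apply: local_frac_refl.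
Qed.

Lemma section_map_sections U s : sections U s ->
  sections (spec_map phi @^-1` U) (section_map phi s).
Proof.
move=> [s0 sP]; split=> [q Uq|q Uq].
  by rewrite /section_map /= s0 //; apply/seteqP; split=> // y [].
have [V [a [b [Vo Vq VU Vs]]]] := sP _ Uq.
exists (spec_map phi @^-1` V), (phi a), (phi b); split=> //.
- by apply: open_comp Vo => x _; apply: continuous_spec_map.
- by move=> x; apply: VU.
- by move=> x /Vs[bx sx]; split=> //; apply: section_map_frac.
Qed.

Lemma sections_local_frac (U : set (spec B)) s p : sections U s -> U p ->
  exists a b, b \notin spec_ideal p /\ s p = local_frac p a b.
Proof. by move=> [_ sP] /sP[V [a [b [_ Vp _ /(_ _ Vp)]]]]; exists a, b. Qed.

Lemma spec_isomorphism_rmorphism_can : spec_isomorphism phi.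
Proof.
have KP := spec_mapK psiK; have KP' := spec_mapK phiK.
split.
  exists (spec_map psi); split=> //; exact: continuous_spec_map.
move=> U Uo; split.
- by move=> s /= sU; apply: section_map_sections.
- move=> s s' /set_mem sU /set_mem s'U ss'; apply/funext => p.
  have [Up|nUp] := pselect (U p); last first.
    (* Outside U both sections take the default value [set0]. *)
    by have [-> //] := sU; have [-> //] := s'U.
  have [a [b [pb sp]]] := sections_local_frac sU Up.
  have [a' [b' [pb' s'p]]] := sections_local_frac s'U Up.
  pose q := spec_map psi p.
  have qp : spec_map phi q = p by apply: KP'.
  rewrite sp s'p; apply: local_frac_eq => //.
  rewrite -qp; apply/local_frac_map => /=.
  move: ss' => /(congr1 (@^~ q)) /=.
  rewrite (@section_map_frac s q a b) ?(@section_map_frac s' q a' b') ?qp // => ->.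
  by apply: local_frac_refl; rewrite -qp in pb'.
- move=> s' [s'0 s'P].
  (* The preimage section pulls each class back along [phi]. *)
  pose s p := [set x | s' (spec_map psi p) (phi x.1, phi x.2)].
  have sE q a b : s' q = local_frac q (phi a) (phi b) ->
      s (spec_map phi q) = local_frac (spec_map phi q) a b.
    move=> s'q; apply/seteqP; split=> x; rewrite /s /= KP s'q.
      by move/local_frac_map.
    by move=> abx; apply/local_frac_map.
  have sU : sections U s.
    split=> [p nUp|p Up].
      by apply/seteqP; split=> // x; rewrite /s /= s'0 // /= KP'.
    have Uq : U (spec_map phi (spec_map psi p)) by rewrite KP'.
    have [V [a [b [Vo Vq VU Vs]]]] := s'P _ Uq.
    exists (spec_map psi @^-1` V), (psi a), (psi b); split=> //.
    + by apply: open_comp Vo => x _; apply: continuous_spec_map.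
    + by move=> x /VU /=; rewrite KP'.
    + move=> x /Vs[bx sx]; split=> //.
      by rewrite -[x]KP'; apply: sE; rewrite !psiK.
  exists s => //; apply/funext => q.
  have [Uq|nUq] := pselect (U (spec_map phi q)); last first.
    have [_ _] := section_map_sections sU.
    by rewrite s'0 //; have [->] := section_map_sections sU.
  have [V [a [b [Vo Vq VU Vs]]]] := s'P _ Uq; have [qb s'q] := Vs _ Vq.
  rewrite (@section_map_frac _ _ (psi a) (psi b)) ?psiK //.
    by rewrite /spec_ideal /= unfold_in psiK.
  by apply: sE; rewrite !psiK.
Qed.

End SpecIso.

(** A set-theoretic inverse of a ring morphism is a ring morphism, so bijectivity of the comorphism
    suffices. *)
Lemma spec_isomorphism_can (B C : comNzRingType) (phi : {rmorphism B -> C})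
    (inv : C -> B) :
  cancel phi inv -> cancel inv phi -> spec_isomorphism phi.
Proof.
move=> phiK invK.
pose psiZ := GRing.isZmodMorphism.Build C B inv (can2_zmod_morphism phiK invK).
pose psiM := GRing.isMonoidMorphism.Build C B inv (can2_monoid_morphism phiK invK).
pose psi : {rmorphism C -> B} := HB.pack inv psiZ psiM.
exact: (@spec_isomorphism_rmorphism_can B C phi psi).
Qed.

End SpecIsomorphism.

(** * Descent along the norm map *)

Section ComplexifiedAlgebra.
Variables (R : realType) (A : falgType R) (sigma : anti_involution A).
Local Notation AC := (complexification A).
Local Notation K := R[i].
Implicit Types (x y : AC) (p q g : {poly K}).

Lemma anti_inv1 : sigma 1 = 1.
Proof.
by rewrite -[RHS](anti_invK sigma) -[X in _ = sigma X]mulr1 anti_invM anti_invK mulr1.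
Qed.

Lemma sigmaC1 : sigmaC sigma 1 = 1.
Proof. by apply: eq_cplx; rewrite /= ?anti_inv1 ?linear0. Qed.

Lemma sigmaC_horner_alg x p :
  sigmaC sigma x = x -> sigmaC sigma (horner_alg x p) = horner_alg x p.
Proof. exact/horner_alg_fixed/sigmaC1/sigmaCM. Qed.

Lemma horner_alg_real (r : A) p : exists p1 p2 : {poly R},
  horner_alg (Cplx r 0 : AC) p = Cplx (horner_alg r p1) (horner_alg r p2).
Proof.
elim/poly_ind: p => [|p c [p1 [p2 IHp]]].
  by exists 0, 0; rewrite !rmorph0.
exists (p1 * 'X + (complex.Re c)%:P), (p2 * 'X + (complex.Im c)%:P).
rewrite !rmorphD !rmorphM /= IHp !horner_algX !horner_algC.
by apply: eq_cplx; rewrite /= !mulr0 ?scaler0 ?subr0 ?add0r ?addr0.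
Qed.

(** For p(r) = u + iv, the parts u, v are commuting symmetric polynomials in r. A zero square means
    u^2 = v^2 and uv = 0, so u^4 = 0. The Hermitian condition gives u^2 = 0 from (u^2, 0), then u =
    v = 0 from (u, v). *)
Lemma symmetric_real_reduced (r : A) p : hermitian_algebra sigma ->
  sigma r = r -> horner_alg (Cplx r 0 : AC) p ^+ 2 = 0 ->
  horner_alg (Cplx r 0 : AC) p = 0.
Proof.
move=> hermA sr; have [p1 [p2 ->]] := horner_alg_real r p.
set u := horner_alg r p1; set v := horner_alg r p2.
have uv : u * v = v * u by rewrite /u /v -!rmorphM mulrC.
move=> [/eqP]; rewrite subr_eq0 => /eqP u2 /eqP.
rewrite -uv -mulr2n -scaler_nat scaler_eq0 pnatr_eq0 /= => /eqP uv0.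
have su : sigma u = u by apply: horner_alg_fixed; [exact: anti_invM|exact: anti_inv1|].
have sv : sigma v = v by apply: horner_alg_fixed; [exact: anti_invM|exact: anti_inv1|].
have u20 : u ^+ 2 = 0.
  apply: (proj1 (hermA (u ^+ 2) 0 _ _ _)); rewrite ?linear0 //.
    by rewrite !expr2 anti_invM su.
  by rewrite !expr2 {2}u2 mulrA -(mulrA u) uv0 !(mulr0, mul0r) addr0.
have [] := hermA u v su sv; first by rewrite u20 expr2 -u2 -expr2 u20 addr0.
by move=> -> ->.
Qed.

End ComplexifiedAlgebra.

(** * Symmetric square roots, polar decomposition and descent of invariants *)

Section NormDescent.
Variables (R : realType) (A : falgType R) (sigma : anti_involution A).
Local Notation AC := (complexification A).
Local Notation K := R[i].
Local Notation N := (@cplx_norm R A sigma).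
Implicit Types (x y : AC) (p q g : {poly K}).

Lemma orthCP x : x \is a GRing.unit -> sigmaC sigma x * x = 1 ->
  exists k : orthC sigma, k = x :> AC.
Proof.
move=> ux sx; have sxV : sigmaC sigma x = x^-1.
  by apply: (mulIr ux); rewrite sx mulVr.
by exists (OrthC ux sxV).
Qed.

(** The root is a polynomial in x, hence symmetric along with x. *)
Lemma symmetric_sqrt x : x \is a GRing.unit -> sigmaC sigma x = x ->
  exists y, [/\ y \is a GRing.unit, sigmaC sigma y = y & y ^+ 2 = x].
Proof.
move=> ux sx.
have [g gx] := @unit_sqrt K AC x ux.
exists (horner_alg x g).
split; last exact: gx.
  by have := ux; rewrite -{1}gx unitrX_pos.
exact: sigmaC_horner_alg.
Qed.

(** For almost all n, s + n is invertible, so it is y^2 = N(y) with y symmetric. Agreement there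
    spreads along the line to s, its point of parameter 0. *)
Lemma cplx_norm_dominant (f f' : subvs_of (symC sigma) -> K) :
  polynomial_function f -> polynomial_function f' ->
  f \o N = f' \o N -> f = f'.
Proof.
move=> pf pf' ff'; apply/funext => s.
have sym1 : (1 : AC) \in symC sigma by rewrite mem_symC sigmaC1.
have [p p_neq0 pP] := @unit_add_nat K AC (vsval s).
rewrite -[s]addr0 -(scale0r (Subvs sym1)).
apply: (polynomial_function_line_eq pf pf' p_neq0) => n /pP us.
set t := s + _; have ut : vsval t \is a GRing.unit by rewrite /t linearD linearZ.
have st : sigmaC sigma (vsval t) = vsval t.
  by apply/eqP; rewrite -mem_symC subvsP.
have [y [_ sy y2]] := symmetric_sqrt ut st.
have -> : t = N y by apply/val_inj; rewrite /= sy -expr2 y2.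
by have := congr1 (@^~ y) ff'.
Qed.

Section Descent.
Variable F : AC -> K.
Hypotheses (polyF : polynomial_function F) (hermA : hermitian_algebra sigma).
Hypothesis invF : forall (k : orthC sigma * orthC sigma) x,
  F (twosided_act k x) = F x.

Lemma orth_invariant (k : orthC sigma) x : F ((k : AC) * x) = F x.
Proof.
have u1 : (1 : AC) \is a GRing.unit by apply: unitr1.
have [|e De] := orthCP u1; first by rewrite sigmaC1 mulr1.
by rewrite -[RHS](invF (k, e)) /twosided_act /= De invr1 mulr1.
Qed.

(** The data g, n, w are fixed before r; only the diagonalization in the proof varies with r. *)
Lemma descent_formula_real : exists g n (w : 'I_n -> K),
  forall r : A, sigma r = r ->
  \sum_l w l * F (horner_alg (1 + l%:R *: (Cplx r 0 ^+ 2 - 1)) g) = F (Cplx r 0).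
Proof.
have [P DF] := polyF.
have [g [n [w wP]]] := even_interpolation K (msize P).
exists g, n, w => r sr; set x : AC := Cplx r 0.
have sx : sigmaC sigma x = x by apply: eq_cplx; rewrite /= ?sr ?linear0.
have [m [a [inja aP]]] := @diagonalizable_of_reduced K AC x
  (fun p => @symmetric_real_reduced R A sigma r p hermA sr).
have aE p q : (forall i, p.[a i] = q.[a i]) -> horner_alg x p = horner_alg x q.
  move=> pq; apply/eqP; rewrite -subr_eq0 -rmorphB; apply/eqP/aP => i.
  by rewrite !hornerE pq subrr.
have [L LP] := lagrange_basis inja.
(* [E z] takes the value z_i at a_i, so at x it gives the sum of the z_i e_i. *)
pose E (z : 'I_m -> K) : {poly K} := \sum_i z i *: L i.
have EP z j : (E z).[a j] = z j.
  rewrite horner_sum (bigD1 j) //= hornerZ LP eqxx mulr1 big1 ?addr0 // => i ij.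
  by rewrite hornerZ LP (negPf ij) mulr0.
pose e := vbasis {:AC}.
(* [Q] is F on the span of the e_i, in the coordinates z. *)
pose Q : {mpoly K[m]} :=
  P \mPo [tuple \sum_j coord e i (horner_alg x (L j)) *: 'X_j | i < \dim {:AC}].
have QE z : Q.@[z] = F (horner_alg x (E z)).
  rewrite comp_mpoly_meval DF /polyfun; apply: meval_eq => i.
  rewrite tnth_mktuple !linear_sum /=; apply: eq_bigr => j _.
  by rewrite mevalZ mevalXU !linearZ /= mulr_algl linearZ /= mulrC.
have <- : horner_alg x (E a) = x.
  by rewrite -[RHS]horner_algX; apply: aE => i; rewrite EP hornerX.
rewrite -QE -wP; last 2 first.
- apply: leq_trans (msize_comp_mpoly_le _ _) (leqnSn _) => i.
  rewrite tnth_mktuple.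
  apply: (big_ind (fun p : {mpoly K[m]} => msize p <= 2)%N).
  + by rewrite msize0.
  + by move=> p q sp sq; rewrite (leq_trans (msizeD_le _ _)) // geq_max sp.
  + by move=> j _; rewrite (leq_trans (msizeZ_le _ _)) // msizeX mdeg1.
(* The sum of the +-e_i is symmetric with square 1, hence orthogonal; multiplying by it changes the
   signs of the coordinates. *)
- move=> eps z; rewrite !QE; pose s i : K := (-1) ^+ eps i.
  have k2 : horner_alg x (E s) * horner_alg x (E s) = 1.
    rewrite -rmorphM -(rmorph1 (horner_alg x)); apply: aE => i.
    by rewrite hornerM EP -expr2 sqrr_sign hornerE.
  have uk : horner_alg x (E s) \is a GRing.unit.
    by apply/unitrP; exists (horner_alg x (E s)).
  have [|k Dk] := orthCP uk; first by rewrite sigmaC_horner_alg.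
  rewrite -(orth_invariant k) Dk -rmorphM; congr F; apply: aE => i.
  by rewrite hornerM !EP /s mulrA -expr2 sqrr_sign mul1r.
apply: eq_bigr => l _; rewrite QE; congr (_ * F _).
(* The argument of F is a polynomial in x, hence determined by its values at the a_i. *)
have -> : 1 + l%:R *: (horner_alg x (E a) ^+ 2 - 1) =
    horner_alg x (1 + l%:R *: ((E a) ^+ 2 - 1)).
  rewrite -mul_polyC rmorphD rmorph1 rmorphM /= horner_algC mulr_algl.
  by rewrite rmorphB rmorph1 rmorphXn.
rewrite -horner_alg_comp; apply: aE => i.
by rewrite EP horner_comp !(hornerD, hornerN, hornerZ, horner_exp) EP !hornerE.
Qed.

Lemma norm_descent : exists f : subvs_of (symC sigma) -> K,
  [/\ polynomial_function f, forall k s, f (conj_act k s) = f s & f \o N = F].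
Proof.
have [g [n [w GF]]] := descent_formula_real.
pose G y := \sum_l w l * F (horner_alg (1 + l%:R *: (y - 1)) g).
have polyG (V : vectType K) (phi : V -> AC) : polynomial_map phi ->
    polynomial_function (G \o phi).
  move=> pphi; apply: polynomial_function_sum => l.
  apply: polynomial_functionM; first exact: polynomial_functionC.
  apply: polynomial_function_comp => //; apply: polynomial_map_horner_alg.
  apply: polynomial_mapD; first exact: polynomial_map_cst.
  under eq_fun do rewrite -mulr_algl.
  apply: polynomial_mapM; first exact: polynomial_map_cst.
  by apply: polynomial_mapD => //; apply: polynomial_map_cst.
have idP : polynomial_map (fun y : AC => y) by move=> i; exact: polynomial_function_coord.
(* On the line a + t b the identity holds at natural t by the real formula, hence also at t = i. *)
have Gsym y : sigmaC sigma y = y -> G (y ^+ 2) = F y.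
  case: y => a b [sa sb].
  have -> : Cplx a b = Cplx a 0 + 'i *: Cplx b 0 :> AC.
    by apply: eq_cplx; rewrite /= ?scale0r ?scaler0 ?scale1r ?subr0 ?add0r ?addr0.
  have polyG2 : polynomial_function (G \o (fun y => y ^+ 2)).
    by apply: polyG; apply: polynomial_mapM.
  apply: (polynomial_function_line_eq polyG2 polyF (oner_neq0 _)) => k _ /=.
  have -> : Cplx a 0 + k%:R *: Cplx b 0 = Cplx (a + k%:R *: b) 0 :> AC.
    rewrite scaler_nat [in RHS]scaler_nat.
    elim: k => [|k IHk]; first by rewrite !mulr0n !addr0.
    by rewrite !mulrSr !addrA IHk; apply: eq_cplx; rewrite /= ?addr0.
  by apply: GF; rewrite linearD linearZ /= sa sb.
have Gnorm y : G (sigmaC sigma y * y) = F y.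
  have [p p_neq0 pP] := @unit_add_nat K AC y.
  have polyGN : polynomial_function (G \o (fun y => sigmaC sigma y * y)).
    apply: polyG; apply: polynomial_mapM => //; exact: polynomial_map_linear.
  rewrite -[y]addr0 -(scale0r 1).
  apply: (polynomial_function_line_eq polyGN polyF p_neq0) => k /pP.
  move: (y + _) => z uz /=; have usz : sigmaC sigma z \is a GRing.unit.
    apply/unitrP; exists (sigmaC sigma z^-1).
    by rewrite -!sigmaCM mulVr ?mulrV // sigmaC1.
  (* Polar decomposition z = k r with r^2 = N(z): k = z r^-1 is orthogonal, so F(z) = F(r). *)
  have [||r [ur sr r2]] := @symmetric_sqrt (sigmaC sigma z * z).
  - by rewrite (@unitrMl AC _ _ uz).
  - by rewrite sigmaCM sigmaCK.
  have urV : r^-1 \is a GRing.unit by rewrite unitrV.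
  have srV : sigmaC sigma r^-1 = r^-1.
    by apply: (mulIr ur); rewrite (mulVr ur) -{2}sr -sigmaCM (mulrV ur) sigmaC1.
  have uk : z / r \is a GRing.unit.
    exact: (etrans (unitrMl z urV) uz).
  have [|k' Dk] := orthCP uk.
    by rewrite sigmaCM srV mulrA -(mulrA r^-1) -r2 expr2 (mulKr ur) (mulrV ur).
  by rewrite -r2 Gsym // -(orth_invariant k') Dk (divrK ur).
exists (G \o vsval); split.
- by apply: polyG; apply: polynomial_map_linear.
(* Conjugating N(y) by k gives N(k y k^-1), where G returns F; dominance extends invariance from
   norms to all symmetric s. *)
- move=> k s; have polyGk : polynomial_function (G \o (vsval \o conj_act k)).
    apply: (polyG _ (fun s : subvs_of (symC sigma) => (k : AC) * vsval s * (k : AC)^-1)).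
    apply: polynomial_mapM; last exact: polynomial_map_cst.
    by apply: polynomial_mapM; [exact: polynomial_map_cst|exact: polynomial_map_linear].
  have polyGv : polynomial_function (G \o @vsval _ _ (symC sigma)).
    by apply: polyG; apply: polynomial_map_linear.
  rewrite -[LHS]/((G \o (vsval \o conj_act k)) s).
  rewrite (cplx_norm_dominant polyGk polyGv) //; apply/funext => y /=.
  have /= <- := congr1 vsval (cplx_norm_equivariant (k, k) y).
  by rewrite !Gnorm invF.
- by apply/funext => y /=; rewrite Gnorm.
Qed.

End Descent.
End NormDescent.

(** * Bijectivity of the comorphism and the isomorphism of quotients *)

Theorem proposition11p16 (R : realType) (A : falgType R)
    (sigma : anti_involution A)
    (ssA : semisimple_algebra A) (hermA : hermitian_algebra sigma) :
  spec_isomorphism (@norm_pullback R A sigma).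
Proof.
have injN : injective (@norm_pullback R A sigma).
  move=> f f' /(congr1 val) /= ff'; apply: val_inj.
  by apply: cplx_norm_dominant ff'; have [] := invariantsP f; have [] := invariantsP f'.
(* Choice provides preimages as data, from which the inverse map [G] is formed. *)
have surjN F : {f | @norm_pullback R A sigma f = F}.
  apply: cid; have [pF iF] := invariantsP F.
  have [f [pf jf fN]] := norm_descent pF hermA (fun k x => iF k x).
  have fP : f \in Defs.invariant (@conj_act R A sigma) by apply/asboolP.
  by exists (Invariants fP); apply: val_inj.
pose G F := sval (surjN F).
have GK : cancel G (@norm_pullback R A sigma) by move=> F; exact: svalP (surjN F).
apply: (spec_isomorphism_can (phi := @norm_pullback R A sigma) _ GK).
by move=> f; apply: injN; rewrite GK.
Qed.
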